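(* Let $k\ge 2$ and $X\subseteq V(G_k)$ with $\operatorname{mm}(X)<k$. Then $R_i\subseteq X$ for some $i$ if and only if $C_j\subseteq X$ for some $j$.
   Context: $G_k$ is the $k\times k$-grid with vertex set $\{(i,j):1\le i,j\le k\}$ and edges $(i,j)(i',j')$ with $|i-i'|+|j-j'|=1$. $C_i=\{(i,j):1\le j\le k\}$ and $R_j=\{(i,j):1\le i\le k\}$. For $X\subseteq V(G_k)$, $\operatorname{mm}(X)$ is the size of a maximum matching in $G_k$ among the edges with one end in $X$ and the other in $V(G_k)\setminus X$. *)

(* Defs.v *)
From mathcomp Require Export all_boot all_order all_algebra.

Set Implicit Arguments.
Unset Strict Implicit.
Unset Printing Implicit Defensive.

(* A simple graph on a finite type is given by its adjacency relation; an edge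
   is the two-element set of its ends. *)

Definition edges (T : finType) (e : rel T) : {set {set T}} :=
  [set [set x; y] | x in T, y in T & e x y].

Definition cut_edges (T : finType) (e : rel T) (X : {set T}) : {set {set T}} :=
  [set [set x; y] | x in X, y in ~: X & e x y].

Definition matching (T : finType) (e : rel T) (M : {set {set T}}) : bool :=
  (M \subset edges e) && trivIset M.

(* The k x k grid; coordinates range over 0, ..., k - 1. *)

Definition grid (k : nat) : finType := ('I_k * 'I_k)%type.

Definition grid_adj (k : nat) : rel (grid k) :=
  fun u v => `|u.1 - v.1|%N + `|u.2 - v.2|%N == 1.

Definition grid_col (k : nat) (i : 'I_k) : {set grid k} :=
  [set (i, j) | j : 'I_k].

Definition grid_row (k : nat) (j : 'I_k) : {set grid k} :=
  [set (i, j) | i : 'I_k].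

Definition mm (k : nat) (X : {set grid k}) : nat :=
  \max_(M : {set {set grid k}} |
          matching (@grid_adj k) M && (M \subset cut_edges (@grid_adj k) X))
     #|M|.

(* Main.v *)
Require Import Defs.
From mathcomp Require Import zify.

(* If X contains a row but no column, then every column meets both X and its
   complement, hence contains a cut edge; the columns being disjoint, these k
   edges form a matching of size k. The converse is the same argument with rows
   and columns exchanged. *)

(** Among all pairs with [P] true at the first entry and false at the second, one at minimal
    distance must be adjacent. *)
Lemma exists_adjacent_switch (k : nat) (P : pred 'I_k) (a b : 'I_k) :
  P a -> ~~ P b -> exists c d : 'I_k, [/\ P c, ~~ P d & `|c - d|%N == 1].
Proof.
move=> Pa Pb; pose Q (p : 'I_k * 'I_k) := P p.1 && ~~ P p.2.
have Qab : Q (a, b) by rewrite /Q Pa.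
case: (arg_minnP (fun p : 'I_k * 'I_k => `|p.1 - p.2|%N) Qab) => -[c d].
move=> /andP[/= Pc Pd] min_cd.
have neq_cd : c != d :> nat by apply: contraNneq Pd => /val_inj <-.
(* [m] is the neighbour of [c] on the side of [d]: if [P m] holds, [(m, d)] beats the minimum;
   otherwise [c], [m] is the switch. *)
have [m m_cd] : exists m : 'I_k, `|c - m|%N = 1 /\ `|m - d|%N < `|c - d|%N.
  have m_lt : (if c < d then c.+1 else c.-1) < k.
    by have := ltn_ord c; have := ltn_ord d; case: ifP => ?; lia.
  by exists (Ordinal m_lt) => /=; case: ifP => ?; lia.
case Pm: (P m); last by exists c, m; rewrite Pc Pm; split=> //; case: m_cd => ->.
by have := min_cd (m, d); rewrite /Q /= Pm Pd => /(_ isT); case: m_cd; lia.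
Qed.

(** The label [c] recovers [i] from either end of the [i]-th edge, so edges with different indices
    share no vertex: they are distinct and form a matching. *)
Lemma leq_mm_of_disjoint_cut_edges (k n : nat) (X : {set grid k})
    (x y : 'I_n -> grid k) (c : grid k -> 'I_n) :
  (forall i, [/\ x i \in X, y i \notin X & grid_adj (x i) (y i)]) ->
  (forall i, c (x i) = i /\ c (y i) = i) ->
  n <= mm X.
Proof.
move=> xyX cK; pose E i := [set x i; y i].
have cE i z : z \in E i -> c z = i.
  by rewrite !inE => /orP[]/eqP->; have [] := cK i.
have E_inj : injective E.
  move=> i j eqE; rewrite -(cE j (x i)); last by rewrite -eqE set21.
  by have [->] := cK i.
rewrite -[n]card_ord -cardsT -(card_imset _ E_inj).
apply: (@leq_bigmax_cond _ _ (fun M : {set {set grid k}} => #|M|)).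
apply/andP; split; first (apply/andP; split).
- apply/subsetP => _ /imsetP[i _ ->]; have [_ _ adj] := xyX i.
  by apply/imset2P; exists (x i) (y i); rewrite ?inE.
- apply/trivIsetP => _ _ /imsetP[i _ ->] /imsetP[j _ ->] neqE.
  apply/pred0Pn => -[z /andP[/= /cE ci /cE cj]].
  by case/eqP: neqE; rewrite -ci -cj.
- apply/subsetP => _ /imsetP[i _ ->]; have [xX yX adj] := xyX i.
  by apply/imset2P; exists (x i) (y i); rewrite ?inE ?yX.
Qed.

(** [line] stands for columns or for rows, so one argument serves both directions of the
    equivalence; [c] tells on which line a vertex lies. *)
Lemma leq_mm_of_mixed_lines (k : nat) (X : {set grid k})
    (line : 'I_k -> 'I_k -> grid k) (c : grid k -> 'I_k) :
  (forall i j, c (line i j) = i) ->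
  (forall i j j' : 'I_k, `|j - j'|%N == 1 -> grid_adj (line i j) (line i j')) ->
  (forall i, exists a b, line i a \in X /\ line i b \notin X) ->
  k <= mm X.
Proof.
move=> cK adj mixed.
have /fin_all_exists[s sP] i : exists s : 'I_k * 'I_k,
    [/\ line i s.1 \in X, line i s.2 \notin X & `|s.1 - s.2|%N == 1].
  have [a [b [aX bX]]] := mixed i.
  have [p [q pq]] := @exists_adjacent_switch _ [pred j | line i j \in X] _ _ aX bX.
  by exists (p, q).
apply: (@leq_mm_of_disjoint_cut_edges _ _ _
  (fun i => line i (s i).1) (fun i => line i (s i).2) c) => i; last by rewrite !cK.
by have [sX s'X /adj] := sP i.
Qed.

Theorem lemma4p2 (k : nat) (hk : 2 <= k) (X : {set grid k}) (hX : mm X < k) :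
  (exists i : 'I_k, grid_row i \subset X) <->
  (exists j : 'I_k, grid_col j \subset X).
Proof.
split=> -[r rX]; apply/existsP; apply: contraLR hX; rewrite negb_exists -leqNgt.
- move=> /forallP noX.
  apply: (@leq_mm_of_mixed_lines _ _ (fun i j => (i, j)) fst) => //.
    by move=> i j j'; rewrite /grid_adj /=; lia.
  move=> i; have /subsetPn[_ /imsetP[j _ ->] jX] := noX i.
  (* Column [i] crosses the full row [r] at [(i, r)], a vertex of [X], while [(i, j)] lies
     outside. *)
  by exists r, j; split=> //; apply: (subsetP rX); apply: imset_f.
- move=> /forallP noX.
  apply: (@leq_mm_of_mixed_lines _ _ (fun j i => (i, j)) snd) => //.
    by move=> i j j'; rewrite /grid_adj /=; lia.
  move=> j; have /subsetPn[_ /imsetP[i _ ->] iX] := noX j.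
  by exists r, i; split=> //; apply: (subsetP rX); apply: imset_f.
Qed.
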